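(* Let $k\ge 4$, let $\beta_k$ be the set partition of $[k]$ with a single block, and let $\sigma$ be a set partition of $[k]$ with exactly two blocks. Then $\sigma\prec\beta_k$; in fact $|\Pi_n(\sigma)|<|\Pi_n(\beta_k)|$ for all $n>k$.
   Context: For a finite set $S$ of positive integers and a set partition of $S$, its standardization is the set partition of $\{1,\dots,|S|\}$ obtained by replacing the $i$-th smallest element of $S$ by $i$. For $\pi\vdash[n]$ and $\tau\vdash[k]$, $\pi$ contains $\tau$ if for some $S\subseteq[n]$ the standardization of the restriction of $\pi$ to $S$ equals $\tau$; otherwise $\pi$ avoids $\tau$. $\Pi_n(\tau)$ denotes the set of set partitions of $[n]$ avoiding $\tau$. For $\tau,\pi\vdash[k]$, $\tau\prec\pi$ means $|\Pi_n(\tau)|\le|\Pi_n(\pi)|$ for all $n>k$ and there is $m\ge k$ with $|\Pi_n(\tau)|<|\Pi_n(\pi)|$ for all $n>m$. *)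

(* Defs.v *)
From mathcomp Require Import all_boot.
Set Implicit Arguments.
Unset Strict Implicit.
Unset Printing Implicit Defensive.

(* The ground set [n] = {1, ..., n} is represented by 'I_n = {0, ..., n-1}.   *)

Definition set_partition (n : nat) (P : {set {set 'I_n}}) : bool :=
  partition P [set: 'I_n].

Definition restriction (n : nat) (P : {set {set 'I_n}}) (S : {set 'I_n}) :
    {set {set 'I_n}} :=
  [set B :&: S | B in P] :\ set0.

(* Number of elements of S below x: the 0-based position of x \in S in the    *)
(* increasing enumeration of S.                                               *)
Definition rank_in (n : nat) (S : {set 'I_n}) (x : 'I_n) : nat :=
  #|[set y in S | y < x]|.

(* Standardization of a partition Q of S. It is meaningful only when #|S| = k *)
(* (the codomain 'I_k is a parameter in order to avoid a cast from 'I_#|S|),  *)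
(* which contains below imposes.                                              *)
Definition standardization (n k : nat) (S : {set 'I_n}) (Q : {set {set 'I_n}}) :
    {set {set 'I_k}} :=
  [set [set i : 'I_k | [exists x in B, rank_in S x == i]] | B : {set 'I_n} in Q].

Definition contains (n k : nat) (P : {set {set 'I_n}}) (t : {set {set 'I_k}}) :
    bool :=
  [exists S : {set 'I_n},
    (#|S| == k) && (standardization k S (restriction P S) == t)].

Definition avoiders (n k : nat) (t : {set {set 'I_k}}) : {set {set {set 'I_n}}} :=
  [set P | set_partition P & ~~ contains P t].

Definition prec (k : nat) (t p : {set {set 'I_k}}) : Prop :=
  (forall n : nat, k < n -> #|avoiders n t| <= #|avoiders n p|) /\
  (exists2 m : nat, k <= m &
     forall n : nat, m < n -> #|avoiders n t| < #|avoiders n p|).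

Definition one_block (k : nat) : {set {set 'I_k}} := [set [set: 'I_k]].

(* Main.v *)
Require Import Defs.
From mathcomp Require Import all_boot.
From mathcomp Require Import zify.
Set Implicit Arguments.
Unset Strict Implicit.
Unset Printing Implicit Defensive.

(** Let sigma have blocks X and ~: X. In a sigma-avoider P, cut every block B
    into pieces of size < k that form a star: a copy of sigma runs across a
    central piece and each of the other pieces. Two pieces joined by such a
    copy cannot come from different blocks of a sigma-avoider, so P can be
    recovered from its pieces, and the cutting is an injection from the
    sigma-avoiders to the partitions with all blocks of size < k.

    A star on a set of m >= k elements comes from the word of sigma: give every
    element of X the colour 0 and replace every other element by a run of
    colours 1, ..., q; the remainder of the division of m - #|X| by #|~: X| is
    absorbed by the colours 0 and 1. When n > k this freedom gives two
    different stars on the whole of [n]. Each of them could only be the image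
    of the partition with one block, so one of them is not in the image. *)

(** * Star words *)

Definition recolor (j : nat) (w : bitseq) : seq nat :=
  [seq if b then 0 else j | b <- w].

(** The word [u] lists the colours of the elements of a block in increasing order. Its colour
    classes are the pieces, and colour 0 is the central one. *)
Definition star_word (w : bitseq) (u : seq nat) : Prop :=
  [/\ 0 \in u, forall j, count_mem j u < size w &
      forall j, j \in u -> j != 0 -> subseq (recolor j w) u].

Definition core_word (q : nat) (w : bitseq) : seq nat :=
  flatten [seq if b then [:: 0] else iota 1 q | b <- w].

Lemma size_core_word q w : size (core_word q w) = count id w + q * count negb w.
Proof.
elim: w => [|[] w IHw] /=; rewrite ?muln0 ?IHw //.
by rewrite size_cat size_iota IHw mulnDr muln1 addnCA.
Qed.

Lemma count_core_word q w j :
  count_mem j (core_word q w) =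
  if j == 0 then count id w else (j <= q) * count negb w.
Proof.
elim: w => [|[] w IHw] /=; first by rewrite muln0 if_same.
  by rewrite {}IHw; case: j.
rewrite count_cat {}IHw count_uniq_mem ?iota_uniq // mem_iota add1n ltnS.
by case: j => [|j] //=; rewrite mulnDr muln1.
Qed.

Lemma subseq_core_word q w j :
  0 < j <= q -> subseq (recolor j w) (core_word q w).
Proof.
move=> hj; elim: w => [|[] w IHw] //=.
by rewrite -[j :: _]cat1s cat_subseq // sub1seq mem_iota add1n ltnS.
Qed.

(** All the copies sit inside [core_word q w], so a prefix [v] with colours at most [q] only has to
    respect the bound on the sizes of the classes. *)
Lemma star_word_cat q w v :
  0 < count id w -> {in v, forall j, j <= q} ->
  (forall j, count_mem j v + count_mem j (core_word q w) < size w) ->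
  star_word w (v ++ core_word q w).
Proof.
move=> w_gt0 v_le size_lt; split.
- rewrite mem_cat -[0 \in core_word _ _]has_pred1 has_count count_core_word.
  by rewrite w_gt0 orbT.
- by move=> j; rewrite count_cat.
move=> j ju j0; apply: subseq_trans (suffix_subseq _ _).
apply: subseq_core_word; rewrite lt0n j0 /=.
move: ju; rewrite mem_cat => /orP[/v_le//|].
rewrite -has_pred1 has_count count_core_word (negPf j0).
by case: (j <= q).
Qed.

Lemma ex_star_word w m :
  0 < count id w -> 0 < count negb w -> size w <= m ->
  exists2 u, size u = m & star_word w u.
Proof.
move=> a0 b0 le_m; have szw : count id w + count negb w = size w.
  by rewrite -(count_predC id w).
have := divn_eq (m - count id w) (count negb w).
have := ltn_pmod (m - count id w) b0.
move: (_ %/ _) (_ %% _) => q s lt_s eq_m.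
(* The remainder [s] goes to colour 0, whose count [s + count id w] stays below [size w] because
   [s < count negb w]. *)
exists (nseq s 0 ++ core_word q w).
  by rewrite size_cat size_nseq size_core_word; lia.
apply: star_word_cat => // [j|j]; first by rewrite mem_nseq => /andP[_ /eqP->].
rewrite count_nseq count_core_word /= eq_sym; case: eqP => _; first lia.
by case: (j <= q); lia.
Qed.

(** Two words with different letters can cut a block in the same way; this relation forgets the
    names of the colours. *)
Definition same_kernel (u v : seq nat) : Prop :=
  forall i j, i < size u -> j < size u ->
    (nth 0 u i == nth 0 u j) = (nth 0 v i == nth 0 v j).

Lemma same_kernel_count u v i :
  size u = size v -> same_kernel u v -> i < size u ->
  count_mem (nth 0 u i) u = count_mem (nth 0 v i) v.
Proof.
move=> eq_sz kuv lt_i.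
rewrite -{2}(mkseq_nth 0 u) -{2}(mkseq_nth 0 v) /mkseq !count_map -eq_sz.
apply: eq_in_count => j; rewrite mem_iota /= add0n => lt_j.
exact: kuv.
Qed.

Lemma ex_two_star_words w m :
  1 < count id w -> 0 < count negb w -> 4 <= size w -> size w < m ->
  exists u v, [/\ size u = m, size v = m, star_word w u, star_word w v &
                  ~ same_kernel u v].
Proof.
move=> a1 b0 sz4 lt_m; have szw : count id w + count negb w = size w.
  by rewrite -(count_predC id w).
have := divn_eq (m - count id w) (count negb w).
have := ltn_pmod (m - count id w) b0.
move: (_ %/ _) (_ %% _) => q s lt_s eq_m.
have q1 : 0 < q.
  by rewrite lt0n; apply/eqP=> q0; rewrite q0 in eq_m; lia.
case: (posnP s) => [s0|s_gt0].
- have q2 : 1 < q.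
    by case: q q1 eq_m => [|[|q]] // _ eq_m; lia.
  (* With no remainder, one round of the [q] colours is given up: its [count negb w] letters become
     one 1 and otherwise 0. Colour 1 then occurs [(count negb w).+1] times, which is below [size w]
     since [1 < count id w]. *)
  exists (1 :: nseq (count negb w).-1 0 ++ core_word q.-1 w), (core_word q w).
  split.
  + rewrite /= size_cat size_nseq size_core_word; nia.
  + by rewrite size_core_word; nia.
  + rewrite -cat_cons; apply: star_word_cat => [|j|j]; first lia.
      rewrite inE mem_nseq => /orP[/eqP->|/andP[_ /eqP->]]; lia.
    rewrite /= count_nseq count_core_word /=.
    by case: j => [|[|j]] /=; lia.
  + rewrite -[core_word _ _]cat0s; apply: star_word_cat => // [|j]; first lia.
    by rewrite /= count_core_word; case: j => [|j] /=; lia.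
  have countE i : i < m ->
    let c := count_mem (nth 0 (core_word q w) i) (core_word q w) in
    c = count id w \/ c = count negb w.
    move=> lt_i /=.
    have /(mem_nth 0) : i < size (core_word q w) by rewrite size_core_word; nia.
    rewrite -has_pred1 has_count count_core_word.
    by case: (nth _ _ _) => [|j] /=; lia.
  set u := _ :: _; set v := core_word q w.
  have szu : size u = m by rewrite /= size_cat size_nseq size_core_word; nia.
  have szv : size v = m by rewrite size_core_word; nia.
  have cu j : count_mem j u = if j == 0 then (size w).-1 else
                 (j == 1) + (j <= q.-1) * count negb w.
    rewrite /u /= count_cat count_nseq count_core_word /=.
    by case: j => [|[|j]] /=; lia.
  (* In v every colour has count [count id w] or [count negb w]; in u the
     colours 1 and 0 have counts [(count negb w).+1] and [(size w).-1]. *)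
  move=> kuv.
  have c1 := same_kernel_count (etrans szu (esym szv)) kuv.
  have := c1 0; rewrite szu cu /= => /(_ ltac:(lia)) e1.
  have := countE 0 ltac:(lia); rewrite /= -/v -e1 => e1'.
  have z_u : 0 \in u.
    by rewrite -has_pred1 has_count cu /=; lia.
  have := c1 (index 0 u); rewrite index_mem z_u nth_index // cu /= => /(_ isT) e2.
  have := countE (index 0 u); rewrite -szu index_mem z_u => /(_ isT) /=.
  rewrite -/v -e2 => e2'.
  (* The first letter forces [count id w = (count negb w).+1], and the colour 0 then forces
     [count negb w = 1]. So [size w] would be 3. *)
  have hq : (0 < q.-1) = true by lia.
  rewrite hq in e1'; lia.
(* With a positive remainder, one of the [s] extra letters may be 0 or 1. Comparing it with a later
   0 separates the kernels. *)
exists (0 :: nseq s.-1 0 ++ core_word q w), (1 :: nseq s.-1 0 ++ core_word q w).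
split.
- by rewrite /= size_cat size_nseq size_core_word; lia.
- by rewrite /= size_cat size_nseq size_core_word; lia.
- rewrite -cat_cons; apply: star_word_cat => [|j|j]; first lia.
    by rewrite inE mem_nseq => /orP[/eqP->|/andP[_ /eqP->]].
  rewrite /= count_nseq count_core_word /=.
  by case: j => [|j] /=; lia.
- rewrite -cat_cons; apply: star_word_cat => [|j|j]; first lia.
    by rewrite inE mem_nseq => /orP[/eqP->|/andP[_ /eqP->]].
  rewrite /= count_nseq count_core_word /=.
  by case: j => [|[|j]] /=; lia.
set r := nseq _ _ ++ _.
have z_r : 0 \in r.
  rewrite mem_cat -[0 \in core_word _ _]has_pred1 has_count count_core_word.
  by rewrite (ltnW a1) orbT.
move=> /(_ 0 (index 0 r).+1 isT); rewrite /= ltnS index_mem z_r nth_index //.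
by move=> /(_ isT).
Qed.

(** * Crossing blocks *)

Lemma block_eq (T : finType) (P : {set {set T}}) (A : {set T}) B C x :
  partition P A -> B \in P -> C \in P -> x \in B -> x \in C -> B = C.
Proof.
move=> partP BP CP xB xC; have trP := partition_trivIset partP.
by rewrite -(def_pblock trP BP xB) (def_pblock trP CP xC).
Qed.

Lemma card_ord_lt k (i : 'I_k) : #|[set j : 'I_k | j < i]| = i.
Proof.
have w_inj : injective (widen_ord (ltnW (ltn_ord i))).
  by move=> j l [] /val_inj.
rewrite -[RHS]card_ord -(card_imset predT w_inj).
apply: eq_card => j; rewrite inE.
apply/idP/imsetP => [lt_ji | [l _ ->]] /=; last exact: ltn_ord.
by exists (Ordinal lt_ji) => //; apply: val_inj.
Qed.

(** This is a copy of the partition with blocks [X] and [~: X], running across [D] and [E]. These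
    may be mere pieces of blocks, and enlarging them keeps the copy. *)
Definition crosses k n (X : {set 'I_k}) (D E : {set 'I_n}) : Prop :=
  exists2 e : 'I_k -> 'I_n, {homo e : i j / i < j} &
    forall i, e i \in if i \in X then D else E.

(** Take the image of [e] as [S]. Since [e] enumerates it increasingly, [e i] has rank [i], and [D]
    and [E] are the only blocks that meet it. *)
Lemma crosses_contains k n (X : {set 'I_k}) (P : {set {set 'I_n}}) D E :
  X != set0 -> ~: X != set0 -> set_partition P -> D \in P -> E \in P ->
  D != E -> crosses X D E -> contains P [set X; ~: X].
Proof.
move=> X0 CX0 partP DP EP neqDE [e e_mono eDE].
have e_inj : injective e.
  by move=> i j; case: (ltngtP i j) => [/e_mono|/e_mono|/val_inj//] + eq_e;
     rewrite eq_e ltnn.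
have eP i B : B \in P -> (e i \in B) = (B == if i \in X then D else E).
  move=> BP; have := eDE i; case: ifP => _ ei.
    by apply/idP/eqP => [eiB | ->//]; exact: block_eq partP BP DP eiB ei.
  by apply/idP/eqP => [eiB | ->//]; exact: block_eq partP BP EP eiB ei.
pose S := [set e i | i : 'I_k].
have eS i : e i \in S by apply: imset_f.
have rankE i : rank_in S (e i) = i.
  rewrite -[RHS]card_ord_lt -(card_imset _ e_inj); apply: eq_card => y.
  rewrite !inE; apply/andP/imsetP => [[/imsetP[j _ ->] lt_e]|[j]].
    exists j => //; rewrite inE ltnNge; apply/negP => le_ij.
    by move: lt_e; rewrite ltnNge leq_eqVlt; move: le_ij; rewrite leq_eqVlt =>
      /orP[/eqP/val_inj->|/e_mono->]; rewrite ?eqxx ?orbT.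
  by rewrite inE => /e_mono lt_e ->; split.
have stdE B : B \in P ->
    [set i : 'I_k | [exists x in B :&: S, rank_in S x == i]] =
    [set i | B == if i \in X then D else E].
  move=> BP; apply/setP => i; rewrite !inE -eP //; apply/existsP/idP.
    by case=> x; rewrite inE => /andP[/andP[xB /imsetP[j _ eq_x]]];
       rewrite eq_x rankE => /eqP/val_inj <-; rewrite -eq_x.
  by move=> eiB; exists (e i); rewrite inE eiB eS rankE eqxx.
have stdD : [set i | D == if i \in X then D else E] = X.
  by apply/setP => i; rewrite inE; case: ifP; rewrite ?eqxx // (negPf neqDE).
have stdEE : [set i | E == if i \in X then D else E] = ~: X.
  apply/setP => i; rewrite !inE; case: ifP; rewrite ?eqxx //.
  by rewrite eq_sym (negPf neqDE).
apply/existsP; exists S; rewrite card_imset // card_ord eqxx /=.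
suff -> : restriction P S = [set D :&: S; E :&: S].
  by rewrite /standardization imsetU1 imset_set1 !stdE // stdD stdEE.
apply/setP => B; rewrite !inE; apply/andP/orP => [[B0 /imsetP[C CP eq_B]]|].
  have /set0Pn[x] := B0; rewrite eq_B inE => /andP[xC /imsetP[i _ eq_x]].
  move: xC; rewrite eq_x eP //; case: ifP => _ /eqP ->; [by left | by right].
case=> /eqP ->; split; try (by apply: (imset_f (fun B => B :&: S)));
  apply/set0Pn.
  by have /set0Pn[i iX] := X0; exists (e i); rewrite inE eS eP // iX eqxx.
have /set0Pn[i] := CX0; rewrite inE => /negPf iX.
by exists (e i); rewrite inE eS eP // iX eqxx.
Qed.

Definition star k n (X : {set 'I_k}) (B : {set 'I_n}) (Q : {set {set 'I_n}}) :=
  [/\ partition Q B, forall D, D \in Q -> #|D| < k &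
      exists2 C, C \in Q & forall D, D \in Q -> D != C -> crosses X C D].

Lemma crossesS k n (X : {set 'I_k}) (D E D' E' : {set 'I_n}) :
  D \subset D' -> E \subset E' -> crosses X D E -> crosses X D' E'.
Proof.
move=> sD sE [e e_mono eDE]; exists e => // i.
by have := eDE i; case: ifP => _; [apply: (subsetP sD) | apply: (subsetP sE)].
Qed.

(** Let [E] be the block of [P] around the central piece. If another piece lay in a different block
    [F], the copy joining the two pieces would run across [E] and [F], which [P] forbids. *)
Lemma star_sub_block k n (X : {set 'I_k}) (P Q : {set {set 'I_n}}) B :
  X != set0 -> ~: X != set0 -> P \in avoiders n [set X; ~: X] -> star X B Q ->
  (forall D, D \in Q -> exists2 E, E \in P & D \subset E) ->
  exists2 E, E \in P & B \subset E.
Proof.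
move=> X0 CX0; rewrite inE => /andP[partP avP] [partQ _ [C CQ crC]] subQ.
have [E EP sCE] := subQ C CQ; exists E => //.
rewrite -(cover_partition partQ); apply/bigcupsP => D DQ.
have [->//|neqDC] := eqVneq D C; have [F FP sDF] := subQ D DQ.
have [->//|neqEF] := eqVneq E F.
rewrite (crosses_contains X0 CX0 partP EP FP) // in avP.
by apply: crossesS (crC D DQ neqDC).
Qed.

(** * Refinement of partitions, and partitions into small blocks *)

Lemma refine_anti (T : finType) (P P' : {set {set T}}) A :
  partition P A -> partition P' A ->
  (forall B, B \in P -> exists2 C, C \in P' & B \subset C) ->
  (forall B, B \in P' -> exists2 C, C \in P & B \subset C) -> P = P'.
Proof.
have half (R R' : {set {set T}}) : partition R A ->
    (forall B, B \in R -> exists2 C, C \in R' & B \subset C) ->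
    (forall B, B \in R' -> exists2 C, C \in R & B \subset C) -> R \subset R'.
  move=> partR sRR' sR'R; apply/subsetP => B BR.
  have [C CR' sBC] := sRR' B BR; have [D DR sCD] := sR'R C CR'.
  have /set0Pn[x xB] := partition_neq0 partR BR.
  have eqBD : B = D.
    exact: block_eq partR BR DR xB (subsetP sCD _ (subsetP sBC _ xB)).
  suff -> : B = C by [].
  by apply/eqP; rewrite eqEsubset sBC eqBD.
move=> partP partP' sPP' sP'P; apply/eqP.
by rewrite eqEsubset !half.
Qed.

Lemma partition_bigcup (T : finType) (P : {set {set T}}) A
    (Q : {set T} -> {set {set T}}) :
  partition P A -> (forall B, B \in P -> partition (Q B) B) ->
  partition (\bigcup_(B in P) Q B) A.
Proof.
move=> partP partQ; apply/and3P; split.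
- rewrite eqEsubset; apply/andP; split; apply/subsetP => x.
    case/bigcupP => C /bigcupP[B BP CQ] xC.
    apply: (subsetP (partitionS partP BP)).
    exact: (subsetP (partitionS (partQ B BP) CQ)).
  rewrite -(cover_partition partP) => /bigcupP[B BP].
  rewrite -(cover_partition (partQ B BP)) => /bigcupP[C CQ xC].
  by apply/bigcupP; exists C => //; apply/bigcupP; exists B.
- apply/trivIsetP => C C' /bigcupP[B BP CB] /bigcupP[B' BP' CB'] neqCC'.
  apply/pred0P => x /=; apply/andP => [[xC xC']].
  have xB := subsetP (partitionS (partQ B BP) CB) x xC.
  have xB' := subsetP (partitionS (partQ B' BP') CB') x xC'.
  have eqB := block_eq partP BP BP' xB xB'; rewrite -eqB in CB'.
  by rewrite (block_eq (partQ B BP) CB CB' xC xC') eqxx in neqCC'.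
by apply/bigcupP => -[B BP]; rewrite (partition0 (partQ B BP)).
Qed.

Lemma small_blocks_avoid_one_block k n (P : {set {set 'I_n}}) :
  set_partition P -> (forall B, B \in P -> #|B| < k) ->
  P \in avoiders n (one_block k).
Proof.
move=> partP smallP; rewrite inE partP /=; apply/existsP => -[S /andP[_ /eqP]].
move=> /setP/(_ [set: 'I_k]); rewrite !inE eqxx.
case/imsetP => B /setD1P[_ /imsetP[C CP eq_B]] eqT.
suff : k <= #|B|.
  rewrite leqNgt (leq_ltn_trans _ (smallP C CP)) //.
  by rewrite eq_B subset_leq_card ?subsetIl.
(* Each of the [k] ranks is attained in [B]; choosing an element for each is injective, as an
   element has only one rank. *)
have ex (i : 'I_k) : exists x : 'I_n, (x \in B) && (rank_in S x == i).
  by apply/existsP; have := in_setT i; rewrite eqT inE.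
have [f fP] := fin_all_exists ex.
have f_inj : injective f.
  move=> i j eq_f; have /andP[_ /eqP ri] := fP i; have /andP[_ /eqP rj] := fP j.
  by apply: ord_inj; rewrite -ri -rj eq_f.
rewrite -[k]card_ord -(card_imset predT f_inj) subset_leq_card //.
by apply/subsetP => _ /imsetP[i _ ->]; have /andP[] := fP i.
Qed.

(** * Stars of blocks *)

Lemma preim_block (T : finType) (rT : eqType) (f : T -> rT) (A : {set T}) B x :
  B \in preim_partition f A -> x \in B -> B = [set y in A | f y == f x].
Proof.
case/imsetP => y _ ->; rewrite inE => /andP[_ /eqP eq_f].
by apply/setP => z; rewrite !inE eq_f eq_sym.
Qed.

(** The letters of [u] are dealt out along [enum B], which is increasing. When [size u = #|B|],
    elements outside [B] get the default colour 0, so colour classes are always cut down to [B]. *)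
Definition coloring n (B : {set 'I_n}) (u : seq nat) (x : 'I_n) : nat :=
  nth 0 u (index x (enum B)).

Lemma map_coloring n (B : {set 'I_n}) u :
  size u = #|B| -> [seq coloring B u x | x <- enum B] = u.
Proof.
move=> szu; apply: (@eq_from_nth _ 0); first by rewrite size_map -cardE.
move=> i; rewrite size_map => lt_i.
have x0 : 'I_n by case: (enum B) lt_i.
by rewrite (nth_map x0) // /coloring index_uniq ?enum_uniq.
Qed.

Lemma sorted_enum_ord n (B : {set 'I_n}) :
  sorted (fun x y : 'I_n => x < y) (enum B).
Proof.
rewrite {1}/enum_mem -enumT; apply: sorted_filter => [x y z|]; first exact: ltn_trans.
by have := iota_ltn_sorted 0 n; rewrite -val_enum_ord sorted_map.
Qed.

Definition word_of k (X : {set 'I_k}) : bitseq :=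
  [seq i \in X | i <- enum 'I_k].

Lemma size_word_of k (X : {set 'I_k}) : size (word_of X) = k.
Proof. by rewrite size_map size_enum_ord. Qed.

Lemma count_word_of k (X : {set 'I_k}) : count id (word_of X) = #|X|.
Proof.
by rewrite count_map cardE {2}/enum_mem -enumT size_filter.
Qed.

Lemma count_negb_word_of k (X : {set 'I_k}) : count negb (word_of X) = #|~: X|.
Proof.
apply/eqP; rewrite -(eqn_add2l #|X|) cardsC card_ord -{1}count_word_of.
by rewrite (count_predC id) size_word_of.
Qed.

(** The mask that selects the subsequence of [u] also selects elements of [enum B]. These form an
    increasing [k]-tuple, which is the required embedding. *)
Lemma crosses_of_subseq k n (X : {set 'I_k}) (B : {set 'I_n}) u j :
  size u = #|B| -> subseq (recolor j (word_of X)) u ->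
  crosses X [set x in B | coloring B u x == 0]
            [set x in B | coloring B u x == j].
Proof.
move=> szu; rewrite -{1}(map_coloring szu) => /subseqP[m szm eq_m].
pose t := mask m (enum B).
have eq_t : [seq coloring B u x | x <- t] = recolor j (word_of X).
  by rewrite map_mask -eq_m.
have szt : size t = k.
  by rewrite -(size_map (coloring B u)) eq_t size_map size_word_of.
have tB x : x \in t -> x \in B by move/mem_mask; rewrite mem_enum.
have t_sorted : sorted (fun x y : 'I_n => x < y) t.
  apply: subseq_sorted (mask_subseq _ _) (sorted_enum_ord B).
  by move=> x y z; apply: ltn_trans.
pose tt := Tuple (introT eqP szt).
exists (tnth tt) => [i l lt_il | i].
  have x0 := tnth tt i; rewrite !(tnth_nth x0) /=.
  apply: (sorted_ltn_nth _ _ t_sorted) => //; rewrite ?inE ?szt //.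
  by move=> x y z; apply: ltn_trans.
have tiB : tnth tt i \in B by apply/tB/mem_tnth.
have : coloring B u (tnth tt i) = if i \in X then 0 else j.
  have x0 := tnth tt i; rewrite (tnth_nth x0) -(nth_map _ 0) /= ?szt // eq_t.
  rewrite (nth_map false) ?size_word_of //.
  by rewrite (nth_map i) ?size_enum_ord // nth_ord_enum.
by case: ifP => _ eq_c; rewrite inE tiB eq_c eqxx.
Qed.

Lemma card_color n (B : {set 'I_n}) u j :
  size u = #|B| -> #|[set x in B | coloring B u x == j]| = count_mem j u.
Proof.
move=> szu; rewrite -[in RHS](map_coloring szu) count_map cardE.
rewrite {1}/enum_mem size_filter {1}/enum_mem count_filter.
by apply: eq_count => y; rewrite /= !inE andbC.
Qed.

Lemma star_of_word k n (X : {set 'I_k}) (B : {set 'I_n}) u :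
  size u = #|B| -> star_word (word_of X) u ->
  star X B (preim_partition (coloring B u) B).
Proof.
move=> szu [u0 small_u sub_u].
have mem_color x : x \in B -> coloring B u x \in u.
  by move=> xB; rewrite -{2}(map_coloring szu) map_f // mem_enum.
split; first exact: preim_partitionP.
- move=> D DQ; have /set0Pn[x xD] := partition_neq0 (preim_partitionP _ _) DQ.
  rewrite (preim_block DQ xD) -[k](size_word_of X).
  by rewrite card_color.
have /mapP[x0 x0B eq_x0] : 0 \in [seq coloring B u x | x <- enum B].
  by rewrite map_coloring.
rewrite mem_enum in x0B.
(* The central piece is the class of colour 0, written through a representative [x0] to match the
   form of [preim_partition]. *)
exists [set y in B | coloring B u x0 == coloring B u y]; first exact: imset_f.
move=> D DQ neqD.
have /set0Pn[x xD] := partition_neq0 (preim_partitionP _ _) DQ.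
have xB : x \in B by apply: (subsetP (partitionS (preim_partitionP _ _) DQ)).
have eqD := preim_block DQ xD.
have neq0 : coloring B u x != 0.
  apply: contraNneq neqD => c0; rewrite eqD -eq_x0 c0.
  by apply/eqP/setP => y; rewrite !inE eq_sym.
have := crosses_of_subseq szu (sub_u _ (mem_color x xB) neq0).
rewrite -eqD -eq_x0; apply: crossesS => //.
by apply/subsetP => y; rewrite !inE eq_sym.
Qed.

Lemma same_kernel_preim n (B : {set 'I_n}) u v :
  size u = #|B| -> size v = #|B| ->
  preim_partition (coloring B u) B = preim_partition (coloring B v) B ->
  same_kernel u v.
Proof.
move=> szu szv eq_parts i j lt_i lt_j; rewrite szu in lt_i lt_j.
have x0 : 'I_n by rewrite cardE in lt_i; case: (enum B) lt_i.
have nth_c w l : l < #|B| -> nth 0 w l = coloring B w (nth x0 (enum B) l).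
  by move=> lt_l; rewrite /coloring index_uniq ?enum_uniq // -cardE.
have nthB l : l < #|B| -> nth x0 (enum B) l \in B.
  by move=> lt_l; rewrite -mem_enum mem_nth // -cardE.
have equiv w :
    {in B & &, equivalence_rel (fun x y => coloring B w x == coloring B w y)}.
  by split=> // /eqP->.
rewrite !nth_c // -!(pblock_equivalence_partition (equiv _)) ?nthB //.
by rewrite -/(preim_partition _ _) eq_parts.
Qed.

Lemma star_exists k n (X : {set 'I_k}) (B : {set 'I_n}) :
  X != set0 -> ~: X != set0 -> B != set0 -> exists Q, star X B Q.
Proof.
move=> X0 CX0 B0; have [lt_B|le_B] := ltnP #|B| k.
  (* A block that is already small is left whole: it is its own central piece. *)
  exists [set B]; split.
  - by rewrite /partition /cover big_set1 eqxx trivIset1 inE eq_sym B0.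
  - by move=> D /set1P->.
  by exists B => [|D /set1P->]; rewrite ?inE ?eqxx.
have [|||u szu star_u] := @ex_star_word (word_of X) #|B|.
- by rewrite count_word_of card_gt0.
- by rewrite count_negb_word_of card_gt0.
- by rewrite size_word_of.
by exists (preim_partition (coloring B u) B); apply: star_of_word.
Qed.

Lemma two_stars_exist k n (X : {set 'I_k}) :
  1 < #|X| -> ~: X != set0 -> 4 <= k < n ->
  exists R R' : {set {set 'I_n}}, [/\ star X setT R, star X setT R' & R <> R'].
Proof.
move=> X1 CX0 /andP[k4 lt_kn].
have [||||u [v [szu szv star_u star_v neq_uv]]] :=
  @ex_two_star_words (word_of X) n.
- by rewrite count_word_of.
- by rewrite count_negb_word_of card_gt0.
- by rewrite size_word_of.
- by rewrite size_word_of.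
have cT : #|[set: 'I_n]| = n by rewrite cardsT card_ord.
exists (preim_partition (coloring setT u) setT),
  (preim_partition (coloring setT v) setT).
split.
- exact: star_of_word (etrans szu (esym cT)) star_u.
- exact: star_of_word (etrans szv (esym cT)) star_v.
by apply: contra_not neq_uv => eq_P; apply: same_kernel_preim eq_P; rewrite ?cT.
Qed.

(** * The injection and its failure to be surjective *)

Lemma lt_avoiders k n (X : {set 'I_k}) :
  1 < #|X| -> ~: X != set0 -> 4 <= k < n ->
  #|avoiders n [set X; ~: X]| < #|avoiders n (one_block k)|.
Proof.
move=> X1 CX0 lt_kn; have X0 : X != set0 by rewrite -card_gt0 ltnW.
(* One star is fixed for every set. The empty set has none, as a star has a central piece, hence the
   guarded form. *)
have exQ (B : {set 'I_n}) : exists Q, B != set0 -> star X B Q.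
  have [-> | B0] := eqVneq B set0; first by exists set0.
  by have [Q starQ] := star_exists X0 CX0 B0; exists Q.
have {exQ}[Q starQ] := fin_all_exists exQ.
pose Phi (P : {set {set 'I_n}}) := \bigcup_(B in P) Q B.
set Av := avoiders n [set X; ~: X].
have partAv P : P \in Av -> partition P setT by rewrite inE => /andP[].
have starP P B : P \in Av -> B \in P -> star X B (Q B).
  by move=> PAv BP; apply/starQ/(partition_neq0 (partAv P PAv) BP).
have PhiP P : P \in Av -> partition (Phi P) setT.
  move=> PAv; apply: partition_bigcup (partAv P PAv) _ => B BP.
  by have [] := starP P B PAv BP.
have Phi_sub P D : P \in Av -> D \in Phi P -> exists2 B, B \in P & D \subset B.
  move=> PAv /bigcupP[B BP DB]; exists B => //.
  by have [partQ _ _] := starP P B PAv BP; apply: partitionS partQ DB.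
have Phi_inj : {in Av &, injective Phi}.
  (* The star of [B] consists of pieces in [Phi P'], each inside a block of [P'], so
     [star_sub_block] puts all of [B] into one block of [P']. By symmetry [P] and [P'] refine each
     other. *)
  have half P P' : P \in Av -> P' \in Av -> Phi P = Phi P' ->
      forall B, B \in P -> exists2 C, C \in P' & B \subset C.
    move=> PAv PAv' eqPhi B BP.
    apply: (star_sub_block X0 CX0 PAv' (starP P B PAv BP)).
    move=> D DB; apply: (Phi_sub P' D PAv'); rewrite -eqPhi.
    by apply/bigcupP; exists B.
  move=> P P' PAv PAv' eqPhi.
  by apply: refine_anti (partAv P PAv) (partAv P' PAv') _ _; apply: half.
have PhiT R P : star X setT R -> P \in Av -> R = Phi P -> P = [set setT].
  move=> starR PAv eqR.
  have [|E EP] := star_sub_block X0 CX0 PAv starR.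
    by move=> D; rewrite eqR; apply: Phi_sub.
  rewrite subTset => /eqP eqE; rewrite {}eqE in EP.
  apply/setP => B; rewrite inE; apply/idP/eqP => [BP | ->//].
  have /set0Pn[x xB] := partition_neq0 (partAv P PAv) BP.
  exact: block_eq (partAv P PAv) BP EP xB (in_setT x).
have PhiAv P : P \in Av -> Phi P \in avoiders n (one_block k).
  move=> PAv; apply: small_blocks_avoid_one_block (PhiP P PAv) _ => D.
  case/bigcupP => B BP; have [_ small_Q _] := starP P B PAv BP.
  exact: small_Q.
have starAv R : star X setT R -> R \in avoiders n (one_block k).
  by case=> partR small_R _; apply: small_blocks_avoid_one_block.
rewrite -(card_in_imset Phi_inj); apply/proper_card/properP; split.
  by apply/subsetP => _ /imsetP[P PAv ->]; apply: PhiAv.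
have [R [R' [starR starR' neqR]]] := two_stars_exist X1 CX0 lt_kn.
(* If both stars were in the image, both would be [Phi [set setT]], hence equal. *)
have [RPhi|RPhi] := boolP (R \in Phi @: Av); last by exists R; rewrite ?starAv.
exists R'; first exact: starAv.
apply/negP => /imsetP[P' PAv' eqR']; case/imsetP: RPhi => P PAv eqR.
apply: neqR.
by rewrite eqR eqR' (PhiT R P) // (PhiT R' P').
Qed.

Theorem theorem3p2 (k : nat) (sigma : {set {set 'I_k}})
    (hk : 4 <= k) (hsigma : set_partition sigma) (hcard : #|sigma| = 2) :
  prec sigma (one_block k) /\
  (forall n : nat, k < n -> #|avoiders n sigma| < #|avoiders n (one_block k)|).
Proof.
suff lt_av : forall n, k < n ->
    #|avoiders n sigma| < #|avoiders n (one_block k)|.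
  by split=> //; split=> [n /lt_av/ltnW|] //; exists k.
move=> n lt_kn.
have /eqP/cards2P[X [Y [neqXY eq_s]]] := hcard.
have Xs : X \in sigma by rewrite eq_s !inE eqxx.
have Ys : Y \in sigma by rewrite eq_s !inE eqxx orbT.
have eqY : Y = ~: X.
  have /and3P[/eqP cov _ _] := hsigma.
  rewrite /cover eq_s bigcup_setU !big_set1 in cov.
  apply/setP => i; rewrite inE; apply/idP/idP => [iY | iX].
    apply: contraNN neqXY => iX; apply/eqP; exact: block_eq hsigma Xs Ys iX iY.
  by have := in_setT i; rewrite -cov inE (negPf iX).
have X0 := partition_neq0 hsigma Xs; have Y0 := partition_neq0 hsigma Ys.
have cXY := cardsC X; rewrite card_ord -eqY in cXY.
have lt4 : 4 <= k < n by rewrite hk.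
have [X1|X1] := ltnP 1 #|X|; first by rewrite eq_s eqY lt_avoiders // -eqY.
(* If [X] is a singleton, then [Y] has at least 3 elements and takes over the central role. *)
have eqX : X = ~: Y by rewrite eqY setCK.
rewrite eq_s setUC eqX lt_avoiders -?eqX //; lia.
Qed.
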